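(* Let $\mathcal{N}$ be an admissible algebra with a grading $\mathcal{N}=\bigoplus_{j>0}\mathcal{N}_j$, let $d:=\max\{j:\mathcal{N}_j\neq\{0\}\}$, and let $\pi:\mathcal{N}\to\mathcal{N}_d$ be the linear projection with kernel $\bigoplus_{j<d}\mathcal{N}_j$. Let $f:=\pi\circ\exp_1:\mathcal{N}\to\mathcal{N}_d$ and $S:=f^{-1}(0)\subset\mathcal{N}$. Let $A(f)$ be the group of all affine transformations $g$ of $\mathcal{N}$ such that $f\circ g=f$. Then $A(f)$ acts transitively on $S$.
   Context: All algebras are over $\mathbb{C}$. A finite-dimensional commutative associative algebra $\mathcal{N}$ is nilpotent if $\mathcal{N}^{\nu+1}=0$ for some $\nu\ge 0$, where $\mathcal{N}^1:=\mathcal{N}$ and $\mathcal{N}^{j+1}$ is the linear span of $\mathcal{N}\,\mathcal{N}^j$. It is admissible if it is nilpotent and its annihilator $\mathrm{Ann}(\mathcal{N}):=\{u\in\mathcal{N}:u\,\mathcal{N}=0\}$ has dimension 1. A grading on $\mathcal{N}$ is a decomposition $\mathcal{N}=\bigoplus_{j>0}\mathcal{N}_j$ into linear subspaces (indexed by positive integers) with $\mathcal{N}_j\mathcal{N}_m\subset\mathcal{N}_{j+m}$; then $\mathrm{Ann}(\mathcal{N})=\mathcal{N}_d$. For $u\in\mathcal{N}$, $\exp_1(u):=\sum_{m\ge1}\frac{u^m}{m!}$ (a finite sum). Affine transformations of $\mathcal{N}$ are the invertible complex affine maps $\mathcal{N}\to\mathcal{N}$. *)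

(* Defs.v *)
From HB Require Import structures.
From mathcomp Require Import all_boot all_order all_algebra.
From mathcomp Require Import all_classical all_reals.
From mathcomp.real_closed Require Export complex.

Set Implicit Arguments.
Unset Strict Implicit.
Unset Printing Implicit Defensive.

Import GRing.Theory.
Local Open Scope classical_set_scope.
Local Open Scope ring_scope.

(* A commutative associative K-algebra structure, not assumed unital, on the
   finite-dimensional space V. *)
Record comm_alg (K : fieldType) (V : vectType K) := CommAlg {
  amul :> V -> V -> V;
  amulA : associative amul;
  amulC : commutative amul;
  amulDl : left_distributive amul +%R;
  amulZl : forall (a : K) (u v : V), amul (a *: u) v = a *: amul u v }.

Section Algebra.
Variables (K : fieldType) (V : vectType K) (N : comm_alg V).
Implicit Types (u v w : V) (U W : {vspace V}).

(* The span of all products of an element of U and an element of W; spanning by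
   products of basis vectors is enough, see subv_aprod. *)
Definition aprod U W : {vspace V} :=
  <<[seq N u w | u <- vbasis U, w <- vbasis W]>>%VS.

(* N^j for j > 0, so N^1 = N and N^(j+1) = N N^j; the value at 0 is junk. *)
Definition alg_power (j : nat) : {vspace V} := iter j.-1 (aprod fullv) fullv.

Definition nilpotent_alg : Prop := exists nu : nat, alg_power nu.+1 = 0%VS.

Definition annihilator : {vspace V} :=
  (\bigcap_(v <- vbasis fullv) lker (linfun (N v)))%VS.

Definition admissible : Prop := nilpotent_alg /\ \dim annihilator = 1%N.

(* u^m for m > 0; the value at 0 is junk. *)
Definition apow u (m : nat) : V := iter m.-1 (N u) u.

(* \sum_(m \in A) is the sum over the finite support of the summand; see exp1E. *)
Definition exp1 u : V := \sum_(m \in [set m | (0 < m)%N]) (m`!%:R)^-1 *: apow u m.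

(* The family (gr j)_(j > 0) is an internal direct sum decomposition of V,
   compatible with the product. As V has finite dimension, the infinite sum
   of the gr j is one of its partial sums. The value of gr at 0 is never used. *)
Definition grading (gr : nat -> {vspace V}) : Prop :=
  [/\ forall n : nat, directv (\sum_(j < n | (0 < j)%N) gr j),
      exists n : nat, (\sum_(j < n | (0 < j)%N) gr j)%VS = fullv
    & forall j m : nat, (0 < j)%N -> (0 < m)%N ->
        forall u v, u \in gr j -> v \in gr m -> N u v \in gr (j + m)%N].

Definition is_top_degree (gr : nat -> {vspace V}) (d : nat) : Prop :=
  [/\ (0 < d)%N, gr d <> 0%VS
    & forall j : nat, (0 < j)%N -> gr j <> 0%VS -> (j <= d)%N].

(* The projection onto gr d along the sum of the gr j, 0 < j < d. *)
Definition top_proj (gr : nat -> {vspace V}) (d : nat) : 'End(V) :=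
  daddv_pi (gr d) (\sum_(j < d | (0 < j)%N) gr j)%VS.

Definition top_exp (gr : nat -> {vspace V}) (d : nat) : V -> V :=
  top_proj gr d \o exp1.

End Algebra.

Section Affine.
Variables (K : fieldType) (V : vectType K).

Definition affine_transformation (g : V -> V) : Prop :=
  bijective g /\ exists (L : 'End(V)) (b : V), forall v, g v = L v + b.

Definition affine_stabilizer (T : Type) (f : V -> T) : set (V -> V) :=
  [set g | affine_transformation g /\ f \o g = f].

End Affine.

(* G, a group of transformations of V under composition, acts on S by
   restriction, with exactly one orbit. *)
Definition acts_transitively (V : Type) (G : set (V -> V)) (S : set V) : Prop :=
  [/\ forall g x, G g -> S x -> S (g x),
      S !=set0
    & forall x y, S x -> S y -> exists2 g, G g & g x = y].

Section AlgebraFacts.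
Variables (K : fieldType) (V : vectType K) (N : comm_alg V).
Implicit Types (u v w : V) (U W T : {vspace V}).

Lemma amulDr : right_distributive N +%R.
Proof. by move=> u v w; rewrite amulC amulDl !(amulC N u). Qed.

Lemma amulZr (a : K) u v : N u (a *: v) = a *: N u v.
Proof. by rewrite amulC amulZl amulC. Qed.

Lemma amul_linear u : linear (N u).
Proof. by move=> a v w; rewrite amulDr amulZr. Qed.

Lemma linfun_amulE u v : linfun (N u) v = N u v.
Proof.
pose M := GRing.isLinear.Build K V V *:%R (N u) (amul_linear u).
pose L : {linear V -> V} := HB.pack (N u) M.
exact: (lfunE L v).
Qed.

Lemma amulr_sum u (I : Type) (r : seq I) (P : pred I) (F : I -> V) :
  N u (\sum_(i <- r | P i) F i) = \sum_(i <- r | P i) N u (F i).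
Proof.
rewrite -linfun_amulE linear_sum; apply: eq_bigr => i _.
exact: linfun_amulE.
Qed.

Lemma subv_aprod U W T :
  (forall u w, u \in U -> w \in W -> N u w \in T) <-> (aprod N U W <= T)%VS.
Proof.
split=> [UWT | sUWT u w uU wW].
  apply/span_subvP => _ /allpairsP[[u w] /= [uU wW ->]].
  by apply: UWT; apply: vbasis_mem.
rewrite (coord_vbasis wW) amulr_sum; apply: memv_suml => i _.
rewrite amulZr; apply: memvZ; rewrite amulC (coord_vbasis uU) amulr_sum.
apply: memv_suml => j _; rewrite amulZr; apply: memvZ.
apply: (subvP sUWT); apply: memv_span; rewrite amulC.
by apply/allpairsP; exists ((vbasis U)`_j, (vbasis W)`_i); split=> //=;
  apply: mem_nth; rewrite size_tuple.
Qed.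

Lemma annihilatorP u : u \in annihilator N <-> forall v, N u v = 0.
Proof.
have capP (s : seq V) : u \in (\bigcap_(v <- s) lker (linfun (N v)))%VS <->
    {in s, forall v, N v u = 0}.
  elim: s => [|v s IHs]; first by rewrite big_nil memvf.
  rewrite big_cons memv_cap memv_ker linfun_amulE; split.
    case/andP=> /eqP vu0 /IHs su0 w; rewrite inE => /predU1P[-> //|].
    exact: su0.
  move=> vs0; rewrite vs0 ?mem_head // eqxx /=; apply/IHs => w ws.
  by apply: vs0; rewrite inE ws orbT.
split=> [/capP u0 v | u0]; last by apply/capP => v _; rewrite amulC.
rewrite (coord_vbasis (memvf v)) amulr_sum big1 // => i _.
by rewrite amulZr amulC u0 ?scaler0 // mem_nth ?size_tuple.
Qed.

Lemma mem_apow u j m : (0 < j)%N -> (j <= m)%N -> apow N u m \in alg_power N j.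
Proof.
case: j => // j _; case: m => // m; rewrite ltnS /apow /alg_power /=.
elim: j m => [|j IHj] m; first by rewrite memvf.
case: m => // m; rewrite ltnS => /IHj um /=.
have /subv_aprod : (aprod N fullv (alg_power N j.+1) <= alg_power N j.+2)%VS.
  exact: subvv.
by apply; rewrite ?memvf.
Qed.

Lemma exp1E nu u : alg_power N nu.+1 = 0%VS ->
  exp1 N u = \sum_(1 <= m < nu.+1) (m`!%:R)^-1 *: apow N u m.
Proof.
move=> N0; rewrite /exp1 [RHS]fsbig_seq ?iota_uniq //.
apply/esym/fsbig_widen.
  by move=> m /=; rewrite mem_index_iota => /andP[].
move=> m /= [m_gt0 /negP]; rewrite mem_index_iota m_gt0 -leqNgt => m_gt.
have := mem_apow u (ltn0Sn nu) m_gt.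
by rewrite N0 memv0 => /eqP ->; rewrite scaler0.
Qed.

Lemma top_projE gr d v w : grading N gr -> (0 < d)%N ->
  v \in gr d -> w \in (\sum_(j < d | (0 < j)%N) gr j)%VS ->
  top_proj gr d (v + w) = v.
Proof.
move=> [gr_direct _ _] d_gt0 vd wlow; rewrite /top_proj.
set low := (\sum_(j < d | _) _)%VS in wlow *.
have cap0 : (gr d :&: low = 0)%VS.
  apply/eqP; rewrite -subv0.
  have /directv_sumP/(_ ord_max d_gt0) <- := gr_direct d.+1.
  apply/capvS => //; apply/subv_sumP => j j_gt0.
  apply: (sumv_sup (widen_ord (leqnSn d) j)) => //.
  by rewrite j_gt0 -val_eqE /= neq_ltn ltn_ord.
rewrite linearD /= (daddv_pi_id cap0 vd).
have := daddv_pi_add cap0 (subvP (addvSr _ _) _ wlow).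
rewrite (daddv_pi_id _ wlow) 1?capvC // => /(canRL (addrK w)).
by rewrite subrr => ->; rewrite addr0.
Qed.

End AlgebraFacts.

Section AffineFacts.
Variables (K : fieldType) (V : vectType K) (T : Type) (f : V -> T).

Lemma affine_stabilizer_id : affine_stabilizer f id.
Proof.
split=> //; split; first by exists id.
by exists \1%VF, 0 => v; rewrite id_lfunE addr0.
Qed.

Lemma affine_stabilizer_comp g h :
  affine_stabilizer f g -> affine_stabilizer f h -> affine_stabilizer f (g \o h).
Proof.
move=> [[bg [L [b gE]]] fg] [[bh [M [c hE]]] fh]; split; last first.
  by rewrite compA fg.
split; first exact: bij_comp.
exists (L \o M)%VF, (L c + b) => v.
by rewrite /= gE hE linearD comp_lfunE addrA.
Qed.

Lemma affine_stabilizer_inv g h :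
  affine_stabilizer f g -> cancel g h -> cancel h g -> affine_stabilizer f h.
Proof.
move=> [[_ [L [b gE]]] fg] gK hK; split; last first.
  by apply/funext => v; rewrite /= -{1}fg /= hK.
split; first by exists g.
have L0 : lker L == 0%VS.
  by apply/lker0P => u v Luv; apply: (can_inj gK); rewrite !gE Luv.
exists (L^-1)%VF, (- (L^-1)%VF b) => v.
by rewrite -{2}(hK v) gE linearD /= lker0_lfunK // addrK.
Qed.

End AffineFacts.

(* Main.v *)
Require Import Defs.
From HB Require Import structures.
From mathcomp Require Import all_boot all_order all_algebra.
From mathcomp Require Import all_classical all_reals.
From mathcomp.real_closed Require Import complex.

Set Implicit Arguments.
Unset Strict Implicit.
Unset Printing Implicit Defensive.

(* The second import restores the meaning of comm_alg, a name that GRing.Theory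
   uses too. *)
Import GRing.Theory.
Import Defs.
Local Open Scope classical_set_scope.
Local Open Scope ring_scope.

(** It suffices to move the point [0] of [S] to any other point [x] of [S].
    Adjoin a unit to [N], so that [exp = 1 + exp1] turns sums into products; in
    positive degree [f] is then the component of degree [d] of [exp].

    The required map is sought in the form [g u = x + theta u].  For an
    element [b] of [N] the twist [theta] multiplies a vector of degree [m] by
    [exp (- m b)].  Because [m |-> exp (- m b)] turns sums into products,
    [theta] is an endomorphism of the unital algebra ([twistM], [twist1]), and
    hence commutes with [exp] ([twist_exp]).  Writing [E = exp u], with
    homogeneous components [E_m],
      [exp (g u) = exp x * theta E = \sum_m exp (x - m b) * E_m],
    and the component of degree [d] of this element is
      [\sum_(m <= d) exp (x - m b)_(d - m) * E_m].
    The term with [m = d] is [E_d], the value [f u].  So [f (g u) = f u] for all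
    [u] as soon as
      [exp (x - (d - k) b)_k = 0] for [0 < k <= d]  ([comp_exp_twist_eq]).
    For [k = d] this is the equation [f x = 0] and does not involve [b].  For
    [k < d] it determines the component [b_k] in terms of the earlier ones:
    [b_k] enters only through the linear term [- (d - k) b_k], and [d - k] is
    invertible ([exp_comp_solvable]).

    The map [theta] is unipotent for the filtration by degree, thus invertible
    ([comp_twist], [twist_inj]), so [g] is an affine transformation, and it
    sends [0] to [x]. *)

(** * The truncated exponential of a commutative algebra *)

Lemma sum_antidiagonals (M : nmodType) n (F : nat -> nat -> M) :
  (forall i j, (n <= i + j)%N -> F i j = 0) ->
  \sum_(i < n) \sum_(j < n) F i j =
  \sum_(k < n) \sum_(i < k.+1) F i (k - i)%N.
Proof.
move=> F0.
have -> : \sum_(k < n) \sum_(i < k.+1) F i (k - i)%N =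
    \sum_(k < n) \sum_(i < n | (i <= k)%N) F i (k - i)%N.
  apply: eq_bigr => k _; rewrite (big_ord_widen n (fun i => F i (k - i)%N)) //.
rewrite [RHS](exchange_big_dep xpredT) //=; apply: eq_bigr => i _.
rewrite -(big_mkord xpredT (F i)) (big_cat_nat (n := n - i)) ?leq_subr //=.
rewrite [X in _ + X]big_nat_cond [X in _ + X]big1 ?addr0; last first.
  by move=> j /andP[/andP[nij _] _]; rewrite F0 // -leq_subLR.
rewrite -(big_mkord (leq i) (fun k => F i (k - i)%N)).
rewrite [RHS](big_cat_nat (n := i)) ?(ltnW (ltn_ord i)) //=.
rewrite [X in _ = X + _]big_nat_cond [X in _ = X + _]big1 ?add0r; last first.
  by move=> j /andP[/andP[_ ji]]; rewrite leqNgt ji.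
have /= := big_addn 0 n i (leq i) (fun k => F i (k - i)%N).
rewrite add0n => ->; apply: congr_big_nat => // j _; first by rewrite leq_addl.
by rewrite addnK.
Qed.

Section TruncatedExponential.
Variables (K : fieldType) (A : comAlgType K).
Implicit Types x y : A.

Definition texp n x : A := \sum_(m < n) (m`!%:R)^-1 *: x ^+ m.

Lemma texpD n x y : [pchar K] =i pred0 ->
  (forall i j, (n <= i + j)%N -> x ^+ i * y ^+ j = 0) ->
  texp n (x + y) = texp n x * texp n y.
Proof.
move=> /pcharf0P charK xy0; rewrite /texp mulr_suml.
under [RHS]eq_bigr do rewrite mulr_sumr.
pose F i j := ((i`!%:R)^-1 *: x ^+ i) * ((j`!%:R)^-1 *: y ^+ j).
rewrite (@sum_antidiagonals A n F) => [|i j nij]; last first.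
  by rewrite /F -scalerAl -scalerAr xy0 ?scaler0.
apply: eq_bigr => k _; rewrite addrC exprDn scaler_sumr.
apply: eq_bigr => i _; rewrite /F -scalerAl -scalerAr scalerA.
rewrite -scaler_nat scalerA mulrC; congr (_ *: _); last by rewrite mulrC.
have ik : (i <= k)%N by rewrite -ltnS.
rewrite -(bin_fact ik) !natrM !invfM mulVKf //.
by rewrite charK -lt0n bin_gt0.
Qed.

End TruncatedExponential.

(** * Graded commutative algebras and their exponential *)

Section Graded.
Variables (K : fieldType) (A : comAlgType K) (n : nat).
Variable comp : nat -> {linear A -> A}.

(** [comp k] is the projection onto the summand of degree [k] of a graded
    unital algebra, all of whose degrees are below [n].  The grading is recorded
    by these projections, because every argument below computes components. *)
Record homogeneous_components : Prop := HomogeneousComponents {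
  comp_sum : forall x, \sum_(i < n) comp i x = x;
  comp_comp : forall i j x, comp i (comp j x) = if i == j then comp j x else 0;
  comp_1 : comp 0 1 = 1;
  comp_homM : forall i j x y,
    comp (i + j) (comp i x * comp j y) = comp i x * comp j y }.

Hypothesis gradedA : homogeneous_components.
Hypothesis charK : [pchar K] =i pred0.
Implicit Types (x y b r : A) (i j k l m : nat).

Lemma comp_ge k x : (n <= k)%N -> comp k x = 0.
Proof.
move=> nk; rewrite -(comp_sum gradedA x) linear_sum big1 // => i _.
by rewrite (comp_comp gradedA) gtn_eqF // (leq_trans (ltn_ord i)).
Qed.

Lemma comp_order_gt0 : (0 < n)%N.
Proof.
rewrite lt0n; apply/eqP => n0; have := comp_1 gradedA.
by rewrite comp_ge ?n0 // => /esym/eqP; rewrite oner_eq0.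
Qed.

Lemma comp_ext x y : (forall k, comp k x = comp k y) -> x = y.
Proof.
move=> xy; rewrite -(comp_sum gradedA x) -(comp_sum gradedA y).
exact: eq_bigr.
Qed.

(** Cutting the double sum of the products [comp i x * comp j y] into
    antidiagonals loses nothing: a product of total degree at least [n] is
    zero. *)
Lemma compM k x y : comp k (x * y) = \sum_(i < k.+1) comp i x * comp (k - i) y.
Proof.
have hom0 i j : (n <= i + j)%N -> comp i x * comp j y = 0.
  by move=> nij; rewrite -(comp_homM gradedA) comp_ge.
have compE k' (i : 'I_k'.+1) :
    comp k (comp i x * comp (k' - i) y) =
    if k == k' then comp i x * comp (k' - i) y else 0.
  have ik' : (i + (k' - i) = k')%N by rewrite subnKC // -ltnS.
  by rewrite -(comp_homM gradedA) (comp_comp gradedA) ik'.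
rewrite -{1}(comp_sum gradedA x) mulr_suml.
under eq_bigr => i _ do rewrite -{1}(comp_sum gradedA y) mulr_sumr.
rewrite (@sum_antidiagonals _ n (fun i j => comp i x * comp j y)) //.
rewrite linear_sum /=; under eq_bigr do rewrite linear_sum /=.
have [kn | nk] := ltnP k n; last first.
  rewrite [RHS]big1 => [|i _]; last by rewrite hom0 // subnKC // -ltnS.
  rewrite big1 // => k' _; rewrite big1 // => i _.
  by rewrite compE gtn_eqF // (leq_trans (ltn_ord k')).
rewrite (bigD1 (Ordinal kn)) //= [X in _ + X]big1 ?addr0 => [|k' k'k].
  by apply: eq_bigr => i _; rewrite compE eqxx.
rewrite big1 // => i _; rewrite compE; case: eqP => // kk'.
by case/negP: k'k; apply/eqP/val_inj.
Qed.

Lemma compM_hom k m x r : comp m r = r ->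
  comp k (x * r) = if (m <= k)%N then comp (k - m) x * r else 0.
Proof.
move=> rm; rewrite compM; have [mk | km] := leqP m k.
  have lt_km : (k - m < k.+1)%N by rewrite ltnS leq_subr.
  rewrite (bigD1 (Ordinal lt_km)) //= subKn // rm big1 ?addr0 // => i ikm.
  rewrite -rm (comp_comp gradedA) ifN ?mulr0 //; apply: contra ikm => /eqP kim.
  by apply/eqP/val_inj; rewrite /= -kim subKn // -ltnS.
rewrite big1 // => i _; rewrite -rm (comp_comp gradedA) ltn_eqF ?mulr0 //.
by rewrite (leq_ltn_trans _ km) ?leq_subr.
Qed.

Lemma homX m l r : comp m r = r -> comp (l * m) (r ^+ l) = r ^+ l.
Proof.
move=> rm; elim: l => [|l IHl]; first by rewrite expr0 (comp_1 gradedA).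
by rewrite exprSr (compM_hom _ _ rm) mulSn leq_addr addKn IHl.
Qed.

Definition vanish_lt k x := forall i, (i < k)%N -> comp i x = 0.

Lemma vanish_ltM j k x y :
  vanish_lt j x -> vanish_lt k y -> vanish_lt (j + k) (x * y).
Proof.
move=> xj yk i ijk; rewrite compM big1 // => m _.
have [mj | jm] := ltnP m j; first by rewrite xj // mul0r.
rewrite yk ?mulr0 // ltn_subLR; last by rewrite -ltnS.
by rewrite (leq_trans ijk) // leq_add2r.
Qed.

Lemma vanish_ltX x m : comp 0 x = 0 -> vanish_lt m (x ^+ m).
Proof.
move=> x0; elim: m => [//|m IHm]; rewrite exprS -add1n.
apply: vanish_ltM => // i; by case: i.
Qed.

Lemma vanish_lt_eq0 k x : (n <= k)%N -> vanish_lt k x -> x = 0.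
Proof.
move=> nk xk; apply: comp_ext => i; rewrite linear0.
by have [/xk // | ki] := ltnP i k; rewrite comp_ge // (leq_trans nk).
Qed.

Notation exp := (texp n).

(** The truncation at [n] is harmless in the augmentation ideal, where a
    product of at least [n] factors lives in degrees at least [n]. *)
Lemma expD x y : comp 0 x = 0 -> comp 0 y = 0 -> exp (x + y) = exp x * exp y.
Proof.
move=> x0 y0; apply: texpD => // i j nij.
by apply: (vanish_lt_eq0 nij); apply: vanish_ltM; apply: vanish_ltX.
Qed.

Lemma comp0_exp x : comp 0 x = 0 -> comp 0 (exp x) = 1.
Proof.
move=> x0; have n0 := comp_order_gt0; rewrite /texp linear_sum /=.
rewrite (bigD1 (Ordinal n0)) //= expr0 linearZ /= (comp_1 gradedA).
rewrite invr1 scale1r.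
rewrite big1 ?addr0 // => m m0; rewrite linearZ /= (vanish_ltX x0) ?scaler0 //.
by rewrite lt0n; apply: contra m0 => /eqP m0; apply/eqP/val_inj.
Qed.

Lemma exp0 : exp (0 : A) = 1.
Proof.
have n0 := comp_order_gt0; rewrite /texp (bigD1 (Ordinal n0)) //=.
rewrite expr0 invr1 scale1r big1 ?addr0 // => m m0.
rewrite expr0n (_ : (m == 0 :> nat) = false) ?scaler0 //.
by apply/negbTE; apply: contra m0 => /eqP m0; apply/eqP/val_inj.
Qed.

(** Up to degree [l] one has [exp r = 1 + r], as [r ^+ m] has degree
    [m * l > l] for [m > 1]; and [exp x] starts with [1].  This is what makes
    the recursion of [exp_comp_solvable] explicit. *)
Lemma comp_expD_hom k l x r : comp 0 x = 0 -> (0 < l)%N -> comp l r = r ->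
  (k <= l)%N ->
  comp k (exp (x + r)) = comp k (exp x) + (if k == l then r else 0).
Proof.
move=> x0 l0 rl kl.
have r0 : comp 0 r = 0 by rewrite -rl (comp_comp gradedA) ltn_eqF.
rewrite expD //.
have [n1 | n1] := leqP n 1.
  (* then n = 1 and the algebra is concentrated in degree 0 *)
  have -> : r = 0 by rewrite -rl comp_ge // (leq_trans n1).
  rewrite exp0 mulr1; case: ifP; by rewrite addr0.
rewrite {2}/texp -(big_mkord xpredT (fun m => (m`!%:R)^-1 *: r ^+ m)).
rewrite big_ltn ?(ltnW n1) // big_ltn // !invr1 !scale1r expr0 expr1.
rewrite !mulrDr mulr1 !linearD /=; congr (_ + _).
rewrite big_nat mulr_sumr linear_sum /= big1 ?addr0 => [|m /andP[m2 _]].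
  rewrite (compM_hom _ _ rl) eqn_leq kl /=; case: ifP => // lk.
  have -> : k = l by apply/eqP; rewrite eqn_leq kl.
  by rewrite subnn comp0_exp // mul1r.
rewrite -scalerAr linearZ /= (compM_hom _ _ (homX m rl)) leqNgt.
rewrite (leq_trans (n := l.+1)) ?scaler0 //.
rewrite (leq_trans _ (leq_mul m2 (leqnn l))) //.
by rewrite mul2n -addnn -addn1 leq_add2l.
Qed.

(** The components of [b] are found one degree after the other: in degree [k]
    the equation reads [c k *: comp k b + (terms in lower components) = 0]. *)
Lemma exp_comp_solvable (c : nat -> K) x l : comp 0 x = 0 ->
  (forall k, (0 < k < l)%N -> c k != 0) ->
  exists2 b, comp 0 b = 0 &
    forall k, (0 < k < l)%N -> comp k (exp (x + c k *: b)) = 0.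
Proof.
move=> x0; elim: l => [_|l IHl c0].
  by exists 0; rewrite ?linear0 // => k /andP[].
have [|b b0 bl] := IHl.
  by move=> k /andP[k0 kl]; rewrite c0 // k0 ltnS ltnW.
have [-> | l0] := posnP l; first by exists b => // k; case: k.
pose r := - (c l)^-1 *: comp l (exp (x + c l *: b)).
have rl : comp l r = r by rewrite linearZ /= (comp_comp gradedA) eqxx.
exists (b + r) => [|k].
  by rewrite linearD /= b0 add0r -rl (comp_comp gradedA) ltn_eqF.
rewrite ltnS => /andP[k0 kl]; rewrite scalerDr addrA (@comp_expD_hom _ l) //.
- case: eqP => [-> | /eqP k_l].
    by rewrite scalerA mulrN divff ?c0 ?l0 /= // scaleN1r subrr.
  by rewrite addr0 bl // k0 ltn_neqAle k_l.
- by rewrite linearD linearZ /= x0 b0 scaler0 addr0.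
- by rewrite linearZ /= rl.
Qed.

(** The grading makes [t] act on vectors of degree [m] by [t ^ (- m)]; this is
    the same formula with the scalar [t] replaced by the unipotent element
    [exp b].  It is multiplicative because [- m] is additive in the degree. *)
Definition twist b x : A := \sum_(m < n) exp (- m%:R *: b) * comp m x.

Lemma twist_is_linear b : linear (twist b).
Proof.
move=> a x y; rewrite /twist scaler_sumr -big_split /=; apply: eq_bigr => m _.
by rewrite linearP /= mulrDr scalerAr.
Qed.

HB.instance Definition _ b :=
  GRing.isLinear.Build K A A *:%R (twist b) (twist_is_linear b).

Section Twist.
Variable b : A.
Hypothesis b0 : comp 0 b = 0.

Lemma comp0Z (c : K) : comp 0 (c *: b) = 0.
Proof. by rewrite linearZ /= b0 scaler0. Qed.

Lemma twistM : {morph twist b : x y / x * y}.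
Proof.
move=> x y; rewrite /twist [RHS]mulr_suml.
under [RHS]eq_bigr do rewrite mulr_sumr.
pose F i j := (exp (- i%:R *: b) * comp i x) * (exp (- j%:R *: b) * comp j y).
have FE i j : F i j = exp (- (i + j)%:R *: b) * (comp i x * comp j y).
  by rewrite /F mulrACA -expD ?comp0Z // -scalerDl natrD opprD.
rewrite (@sum_antidiagonals A n F) => [|i j nij]; last first.
  by rewrite FE -(comp_homM gradedA) comp_ge ?mulr0.
apply: eq_bigr => k _; rewrite compM mulr_sumr; apply: eq_bigr => i _.
by rewrite FE subnKC // -ltnS.
Qed.

Lemma twist1 : twist b 1 = 1.
Proof.
rewrite /twist; have n0 := comp_order_gt0; rewrite (bigD1 (Ordinal n0)) //=.
rewrite oppr0 scale0r exp0 mul1r -(comp_1 gradedA) (comp_comp gradedA) eqxx.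
rewrite big1 ?addr0 // => m m0; rewrite (comp_comp gradedA) ifN ?mulr0 //.
Qed.

Lemma twist_exp x : twist b (exp x) = exp (twist b x).
Proof.
rewrite /texp linear_sum; apply: eq_bigr => m _; rewrite linearZ /=.
congr (_ *: _); elim: (m : nat) => [|k IHk]; first by rewrite !expr0 twist1.
by rewrite !exprS twistM IHk.
Qed.

Lemma comp_exp_twist k x y : comp 0 x = 0 ->
  comp k (exp x * twist b y) =
  \sum_(m < n | (m <= k)%N) comp (k - m) (exp (x - m%:R *: b)) * comp m y.
Proof.
move=> x0; rewrite /twist mulr_sumr linear_sum [RHS]big_mkcond /=.
apply: eq_bigr => m _.
rewrite mulrA -expD ?comp0Z // scaleNr (@compM_hom _ m) //.
by rewrite (comp_comp gradedA) eqxx.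
Qed.

(** The factors [exp (- m b)] start with [1], so the twist changes a vector
    only in degrees above its lowest one. *)
Lemma comp_twist k x : (forall m, (m < k)%N -> comp m x = 0) ->
  comp k (twist b x) = comp k x.
Proof.
move=> xlow; rewrite -[twist b x]mul1r -exp0 comp_exp_twist ?linear0 //.
have [kn | nk] := ltnP k n; last first.
  rewrite comp_ge // big1 // => m _; rewrite xlow ?mulr0 //.
  exact: leq_trans (ltn_ord m) nk.
rewrite (bigD1 (Ordinal kn)) //= subnn comp0_exp ?mul1r; last first.
  by rewrite add0r -scaleNr comp0Z.
rewrite big1 ?addr0 // => m /andP[mk mk']; rewrite xlow ?mulr0 //.
rewrite ltn_neqAle mk andbT; apply: contra mk' => /eqP mk'; exact/eqP/val_inj.
Qed.

Lemma twist_inj : injective (twist b).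
Proof.
move=> x y /eqP; rewrite -subr_eq0 -linearB /= => /eqP xy0.
apply/eqP; rewrite -subr_eq0; apply/eqP/comp_ext => k; rewrite linear0.
elim/ltn_ind: k => k IHk; by rewrite -comp_twist // xy0 linear0.
Qed.

Lemma comp0_twist x : comp 0 x = 0 -> comp 0 (twist b x) = 0.
Proof. by move=> x0; rewrite comp_twist. Qed.

(** In the expansion of [comp_exp_twist] the equations on [b] kill every term
    but the one with [m = d]; there [k] is the complementary degree
    [d - m]. *)
Lemma comp_exp_twist_eq d x y : comp 0 x = 0 ->
  (forall k, (0 < k <= d)%N -> comp k (exp (x - (d - k)%:R *: b)) = 0) ->
  comp d (exp x * twist b y) = comp d y.
Proof.
move=> x0 xb; rewrite comp_exp_twist //.
have mE (m : 'I_n) : (m < d)%N ->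
    comp (d - m) (exp (x - m%:R *: b)) * comp m y = 0.
  move=> md; rewrite -{2}(subKn (ltnW md)) xb ?mul0r //.
  by rewrite subn_gt0 md leq_subr.
have [dn | nd] := ltnP d n; last first.
  rewrite comp_ge // big1 // => m _; exact/mE/(leq_trans (ltn_ord m) nd).
rewrite (bigD1 (Ordinal dn)) //= subnn comp0_exp ?mul1r; last first.
  by rewrite linearB /= x0 comp0Z subr0.
rewrite big1 ?addr0 // => m /andP[md md']; rewrite mE //.
rewrite ltn_neqAle md andbT; apply: contra md' => /eqP md'; exact/eqP/val_inj.
Qed.

End Twist.

(** The recursion for [b] stops below degree [d]: the coefficient [d - k] is
    zero for [k = d], and the equation in degree [d] is the assumption on
    [x]. *)
Lemma exists_twist d x : comp 0 x = 0 -> comp d (exp x) = 0 ->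
  exists2 b, comp 0 b = 0 &
    forall u, comp 0 u = 0 -> comp d (exp (x + twist b u)) = comp d (exp u).
Proof.
move=> x0 xd.
have [k /andP[_ kd]|b b0 xb] :=
    @exp_comp_solvable (fun k => - (d - k)%:R) x d x0.
  by rewrite oppr_eq0 ((pcharf0P K).1 charK) -lt0n subn_gt0.
exists b => // u u0; rewrite expD ?comp0_twist // -twist_exp //.
apply: comp_exp_twist_eq => // k /andP[k0].
rewrite leq_eqVlt => /predU1P[-> | kd].
  by rewrite subnn scale0r subr0.
by rewrite -scaleNr xb // k0.
Qed.

End Graded.

(** * Adjoining a unit to a graded algebra *)

Section Unitization.
Variables (K : fieldType) (V : vectType K).

(** Pairs [(a, u)] stand for [a + u].  The factor [K^o] is the module underlying
    the field [K]. *)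
Definition unitization (N : comm_alg V) : Type := (K^o * V)%type.

Variable N : comm_alg V.
Local Notation A := (unitization N).

HB.instance Definition _ := GRing.Lmodule.on A.

Implicit Types x y : A.

Definition unitization_one : A := (1, 0).

Definition unitization_mul x y : A :=
  (x.1 * y.1, x.1 *: y.2 + y.1 *: x.2 + N x.2 y.2).

Lemma unitization_mulC : commutative unitization_mul.
Proof.
by move=> x y; congr pair; [rewrite mulrC | rewrite amulC [X in X + _]addrC].
Qed.

Lemma unitization_mulDl : left_distributive unitization_mul +%R.
Proof.
move=> x y z; congr pair; first by rewrite /= mulrDl.
rewrite /= amulDl scalerDl scalerDr; set u := N _ _; set v := N _ _.
by rewrite [RHS]addrACA; congr (_ + _); rewrite addrACA.
Qed.

Lemma unitization_mul1 : left_id unitization_one unitization_mul.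
Proof.
move=> [a u]; congr pair; rewrite /= ?mul1r // scale1r scaler0 addr0.
by rewrite -(scale0r 0) amulZl scale0r addr0.
Qed.

Lemma unitization_mulA : associative unitization_mul.
Proof.
move=> [a u] [b v] [c w]; congr pair; rewrite /= ?mulrA //.
rewrite !amulDl !amulDr !amulZl !amulZr !scalerDr !scalerA amulA.
rewrite (mulrC c a) (mulrC c b) -!addrA; congr (_ + _); congr (_ + _).
by rewrite [LHS]addrCA; congr (_ + _); rewrite [RHS]addrCA; congr (_ + _);
  rewrite addrCA.
Qed.

Lemma unitization_one_neq0 : unitization_one != 0.
Proof. by rewrite /eq_op /= oner_eq0. Qed.

HB.instance Definition _ := GRing.Zmodule_isComNzRing.Build A
  unitization_mulA unitization_mulC unitization_mul1 unitization_mulDl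
  unitization_one_neq0.

Lemma unitization_scalerAl (a : K) x y : a *: (x * y) = (a *: x) * y.
Proof.
congr pair; rewrite /= ?scalerAl // !scalerDr amulZl !scalerA.
by rewrite (mulrC a y.1).
Qed.

HB.instance Definition _ :=
  GRing.Lmodule_isLalgebra.Build K A unitization_scalerAl.
HB.instance Definition _ := GRing.Lalgebra_isComAlgebra.Build K A.

Definition ideal_inj (u : V) : A := (0, u).

Lemma ideal_inj_linear : linear ideal_inj.
Proof. by move=> a u v; congr pair; rewrite /= ?addr0 ?scaler0. Qed.

HB.instance Definition _ :=
  GRing.isLinear.Build K V A *:%R ideal_inj ideal_inj_linear.

Lemma ideal_injM u v : ideal_inj u * ideal_inj v = ideal_inj (N u v).
Proof. by congr pair; rewrite /= ?mul0r // !scale0r !add0r. Qed.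

Lemma ideal_injX u m : ideal_inj u ^+ m.+1 = ideal_inj (apow N u m.+1).
Proof.
rewrite /apow /=; elim: m => [|m IHm]; first by rewrite expr1.
by rewrite exprS IHm ideal_injM.
Qed.

End Unitization.

Section GradedUnitization.
Variables (K : fieldType) (V : vectType K) (N : comm_alg V).
Variables (gr : nat -> {vspace V}) (n : nat) (vcomp : nat -> 'End(V)).
Local Notation A := (unitization N).

Hypothesis grN : grading N gr.
Hypothesis vcomp_mem : forall k u, vcomp k u \in gr k.
Hypothesis vcomp_sum : forall u, \sum_(k < n.+1 | (0 < k)%N) vcomp k u = u.
Hypothesis gr_gt : forall k, (n < k)%N -> gr k = 0%VS.

(** A family of maps into the summands that adds up to the identity consists
    of the projections, since a vector has only one decomposition. *)
Lemma vcomp_homE k l u : (0 < k)%N -> (0 < l)%N -> u \in gr l ->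
  vcomp k u = if k == l then u else 0.
Proof.
move=> k0 l0 ul; have [grD _ _] := grN.
have [kn | nk] := leqP k n; last first.
  have /eqP -> : vcomp k u == 0 by rewrite -memv0 -(gr_gt nk).
  by case: eqP => // kl; apply/esym/eqP; rewrite -memv0 -(gr_gt nk) kl.
have [ln | nl] := leqP l n; last first.
  have -> : u = 0 by apply/eqP; rewrite -memv0 -(gr_gt nl).
  by rewrite linear0 if_same.
pose us (i : 'I_n.+1) := vcomp i u.
pose vs (i : 'I_n.+1) := if i == l :> nat then u else 0.
have us_gr (i : 'I_n.+1) : (0 < i)%N -> us i \in gr i.
  by move=> _; apply: vcomp_mem.
have vs_gr (i : 'I_n.+1) : (0 < i)%N -> vs i \in gr i.
  by rewrite /vs => _; case: eqP => [->|] //; rewrite mem0v.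
have /directv_sum_unique/(_ us vs us_gr vs_gr) := grD n.+1.
have -> : \sum_(i < n.+1 | (0 < i)%N) vs i = u.
  rewrite /vs -big_mkcondr (big_pred1 (Ordinal (ln : l < n.+1)%N)) // => i.
  by rewrite /= -val_eqE /=; case: eqP => [->|]; rewrite ?l0 ?andbF.
rewrite vcomp_sum eqxx => /esym/forall_inP/(_ (Ordinal (kn : k < n.+1)%N) k0).
by move=> /eqP.
Qed.

(** The scalars make up the degree [0]. *)
Definition unitization_comp k (x : A) : A :=
  if k is 0%N then (x.1, 0) else (0, vcomp k x.2).

Lemma unitization_comp_linear k : linear (unitization_comp k).
Proof.
by case: k => [|k] a x y; congr pair; rewrite /= ?linearP ?scaler0 ?addr0.
Qed.

HB.instance Definition _ k :=
  GRing.isLinear.Build K A A *:%R (unitization_comp k)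
    (unitization_comp_linear k).

Lemma unitization_compS k u : (0 < k)%N ->
  unitization_comp k (ideal_inj N u) = ideal_inj N (vcomp k u).
Proof. by case: k. Qed.

Lemma unitization_comp_graded :
  homogeneous_components n.+1 (unitization_comp : nat -> {linear A -> A}).
Proof.
split.
- move=> [a u]; rewrite big_ord_recl.
  have -> : \sum_(k < n) unitization_comp (lift ord0 k) (a, u) = ideal_inj N u.
    rewrite -{2}(vcomp_sum u) [in RHS]big_mkcond [in RHS]big_ord_recl /= add0r.
    rewrite linear_sum.
    by apply: eq_bigr.
  by apply: injective_projections; rewrite /= ?addr0 ?add0r.
- case=> [|i] [|j] [a u] //=; first by rewrite linear0.
  by rewrite (@vcomp_homE _ j.+1) //; case: ifP.
- by [].
have N0 u : N u 0 = 0 by rewrite -(scale0r 0) amulZr !scale0r.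
case=> [|i] [|j] [a u] [b v]; apply: injective_projections => //=;
  rewrite ?mul0r ?mulr0 // ?scale0r ?scaler0 ?add0r ?addr0 ?N0
    ?[N 0 _]amulC ?N0 ?add0r ?addr0 //.
- by rewrite linearZ /= (@vcomp_homE _ j.+1) ?eqxx.
- by rewrite addn0 linearZ /= (@vcomp_homE _ i.+1) ?eqxx.
have [_ _ grM] := grN.
rewrite (@vcomp_homE (i + j.+1).+1%N (i.+1 + j.+1)) ?eqxx //.
exact: grM.
Qed.

End GradedUnitization.

(** * The exponential of the graded algebra and its affine symmetries *)

Section TopDegree.
Variables (K : fieldType) (V : vectType K) (N : comm_alg V).
Variables (gr : nat -> {vspace V}) (d : nat).
Hypotheses (grN : grading N gr) (gr_top : is_top_degree gr d).

Lemma gr_gt_top k : (d < k)%N -> gr k = 0%VS.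
Proof.
move=> dk; have [d0 _ gr_le] := gr_top; apply/eqP/negPn/negP => /eqP grk.
by have := gr_le k (ltn_trans d0 dk) grk; rewrite leqNgt dk.
Qed.

Lemma sum_gr_le_top : fullv = (\sum_(0 <= k < d.+1 | (0 < k)%N) gr k)%VS.
Proof.
have [_ [n gr_sum] _] := grN.
apply/esym/eqP; rewrite big_mkord eqEsubv subvf /= -gr_sum.
apply/subv_sumP => k k0; have [kd | dk] := leqP k d.
  exact: (sumv_sup (Ordinal (kd : k < d.+1)%N)).
by rewrite gr_gt_top // sub0v.
Qed.

Definition gr_comp k : 'End(V) := sumv_pi_for sum_gr_le_top k.

Lemma gr_comp_mem k u : gr_comp k u \in gr k.
Proof. exact: memv_sum_pi. Qed.

Lemma gr_comp_sum u : \sum_(k < d.+1 | (0 < k)%N) gr_comp k u = u.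
Proof.
by rewrite -(big_mkord _ (fun k => gr_comp k u)) sumv_pi_nat_sum ?memvf.
Qed.

Lemma top_proj_comp u : top_proj gr d u = gr_comp d u.
Proof.
have [d0 _ _] := gr_top; rewrite -{1}(gr_comp_sum u) big_mkcond big_ord_recr /=.
rewrite d0 addrC (top_projE grN) ?gr_comp_mem // -big_mkcond.
apply: memv_suml => k k0; apply: (subvP (sumv_sup k k0 (subvv _))).
exact: gr_comp_mem.
Qed.

Local Notation A := (unitization N).
Local Notation comp :=
  (unitization_comp (N := N) gr_comp : nat -> {linear A -> A}).

Let gradedA : homogeneous_components d.+1 comp :=
  unitization_comp_graded grN gr_comp_mem gr_comp_sum gr_gt_top.

Lemma apow_gt_top u m : (d < m)%N -> apow N u m = 0.
Proof.
case: m => // m dm; suff: ideal_inj N (apow N u m.+1) = 0 by case.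
rewrite -ideal_injX; apply: (vanish_lt_eq0 gradedA dm).
exact: (vanish_ltX gradedA).
Qed.

Lemma exp_ideal_inj u : texp d.+1 (ideal_inj N u) = 1 + ideal_inj N (exp1 N u).
Proof.
have -> : exp1 N u = \sum_(1 <= m < d.+1) (m`!%:R)^-1 *: apow N u m.
  rewrite /exp1 [RHS]fsbig_seq ?iota_uniq //; apply/esym/fsbig_widen.
    by move=> m /=; rewrite mem_index_iota => /andP[].
  move=> m /= [m0 /negP]; rewrite mem_index_iota m0 -leqNgt => dm.
  by rewrite apow_gt_top ?scaler0.
rewrite /texp big_ord_recl /= expr0 invr1 scale1r; congr (_ + _).
rewrite big_add1 /= big_mkord linear_sum; apply: eq_bigr => m _.
by rewrite linearZ /= ideal_injX.
Qed.

(** The unit has degree [0 < d], so it is invisible in degree [d]. *)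
Lemma comp_top_exp u :
  comp d (texp d.+1 (ideal_inj N u)) = ideal_inj N (top_exp N gr d u).
Proof.
have [d0 _ _] := gr_top.
rewrite exp_ideal_inj linearD /= -{1}(comp_1 gradedA) (comp_comp gradedA).
by rewrite gtn_eqF // add0r unitization_compS // /top_exp /= top_proj_comp.
Qed.

Hypothesis charK : [pchar K] =i pred0.

(** The transformation is the restriction of [x + twist b] to the ideal [N] of
    its unitization, which the twist preserves. *)
Lemma affine_stabilizer_from0 x : top_exp N gr d x = 0 ->
  exists2 g, affine_stabilizer (top_exp N gr d) g & g 0 = x.
Proof.
move=> fx; have x0 : comp 0 (ideal_inj N x) = 0 by [].
have [|b b0 fb] := exists_twist gradedA charK (d := d) x0.
  by rewrite comp_top_exp fx linear0.
pose T u : V := (twist d.+1 comp b (ideal_inj N u)).2.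
have TE u : twist d.+1 comp b (ideal_inj N u) = ideal_inj N (T u).
  apply: injective_projections => //=.
  have u0 : comp 0 (ideal_inj N u) = 0 by [].
  by have /(congr1 fst) := comp0_twist gradedA charK b0 u0.
have T_linear : linear T by move=> a u v; rewrite /T !linearP.
pose TL : {linear V -> V} :=
  HB.pack T (GRing.isLinear.Build K V V *:%R T T_linear).
have T0 : lker (linfun TL) == 0%VS.
  apply/lker0P => u v; rewrite !lfunE /= => Tuv.
  suff: ideal_inj N u = ideal_inj N v by case.
  by apply: (twist_inj gradedA charK b0); rewrite !TE Tuv.
exists (fun u => T u + x); last by rewrite -[T]/(TL : V -> V) linear0 add0r.
split; last first.
  apply/funext => u /=.
  suff: ideal_inj N (top_exp N gr d (T u + x)) =
      ideal_inj N (top_exp N gr d u) by case.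
  by rewrite addrC -!comp_top_exp linearD /= -TE fb.
split; last by exists (linfun TL), x => u; rewrite lfunE.
exists (fun v => (linfun TL)^-1%VF (v - x)) => u.
  by rewrite addrK -[T u]/(TL u) -(lfunE TL) lker0_lfunK.
by rewrite -[T _]/(TL _) -(lfunE TL) lker0_lfunVK // subrK.
Qed.

Lemma top_exp0 : top_exp N gr d 0 = 0.
Proof.
suff: ideal_inj N (top_exp N gr d 0) = 0 by case.
have [d0 _ _] := gr_top.
rewrite -comp_top_exp linear0 (exp0 gradedA) -(comp_1 gradedA).
by rewrite (comp_comp gradedA) gtn_eqF.
Qed.

End TopDegree.

Lemma acts_transitively_fiber (K : fieldType) (V : vectType K) (T : Type)
    (f : V -> T) (x0 : V) :
  (forall x, f x = f x0 -> exists2 g, affine_stabilizer f g & g x0 = x) ->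
  acts_transitively (affine_stabilizer f) (f @^-1` [set f x0]).
Proof.
move=> from0; split=> [g x [_ fg] /= <-| | x y /from0[g fg gx] /from0[h fh hy]].
- by rewrite -{2}fg.
- by exists x0.
have [[[g' gK g'K] _] _] := fg.
exists (h \o g').
  exact: affine_stabilizer_comp fh (affine_stabilizer_inv fg gK g'K).
by rewrite /= -gx gK.
Qed.

Theorem proposition2p4 (R : realType) (V : vectType R[i]) (N : comm_alg V)
    (gr : nat -> {vspace V}) (d : nat)
    (Nadm : admissible N) (Ngr : grading N gr) (dmax : is_top_degree gr d) :
  let f : V -> V := top_exp N gr d in
  let S : set V := f @^-1` [set 0] in
  acts_transitively (affine_stabilizer f) S.
Proof.
move=> f S; rewrite /S -(top_exp0 Ngr dmax).
apply: acts_transitively_fiber => x.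
rewrite (top_exp0 Ngr dmax : f 0 = 0) => fx.
apply: affine_stabilizer_from0 => //.
exact: Num.Theory.pchar_num.
Qed.
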